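(* Let $\mathcal{H}$ be a complex Hilbert space, let $T\in\mathcal{B}(\mathcal{H})$ be generalized Drazin invertible with closed range, let $T^{-}$ be a fixed inner inverse of $T$ and let $T^{GD-}=T^dTT^{-}$ be the corresponding GD1 inverse. Then $T^2T^{-}$ is generalized Drazin invertible and $(T^2T^{-})^d=T^{GD-}$.
   Context: $\mathcal{B}(\mathcal{H})$ is the space of bounded linear operators on $\mathcal{H}$. An operator $Q\in\mathcal{B}(\mathcal{H})$ is quasinilpotent if $\|Q^n\|^{1/n}\to0$ (equivalently, $\lambda I-Q$ is invertible for all $\lambda\neq0$). $T\in\mathcal{B}(\mathcal{H})$ is generalized Drazin invertible if there is $X\in\mathcal{B}(\mathcal{H})$ with $XTX=X$, $TX=XT$ and $T-T^2X$ quasinilpotent; such an $X$ is unique and is denoted $T^d$. An inner inverse of $T$ is $T^{-}\in\mathcal{B}(\mathcal{H})$ with $TT^{-}T=T$ (one exists iff the range of $T$ is closed). *)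

(* Defs.v *)
From HB Require Import structures.
From mathcomp Require Import all_boot all_order all_algebra.
From mathcomp Require Import all_classical all_reals all_analysis.
From mathcomp Require Import complex.

Set Implicit Arguments.
Unset Strict Implicit.
Unset Printing Implicit Defensive.

Import Order.TTheory GRing.Theory Num.Theory.
Import numFieldNormedType.Exports.

Local Open Scope classical_set_scope.
Local Open Scope ring_scope.

(* The inner product is linear in its first argument and antilinear in its
   second one. *)
HB.mixin Record CompleteNormedModule_isHilbert (R : realType) H
    & CompleteNormedModule R[i] H := {
  inner : {dot H for (@Num.conj R[i])};
  sqr_norm_inner : forall x : H, `|x| ^+ 2 = inner x x
}.

#[short(type="hilbertType")]
HB.structure Definition Hilbert (R : realType) :=
  {H of CompleteNormedModule R[i] H & CompleteNormedModule_isHilbert R H}.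

Definition bounded_linear (R : realType) (V : normedModType R[i]) :
    {pred V -> V} :=
  fun T => `[< linear T /\ exists M : R[i], forall x, `|T x| <= M * `|x| >].

Section BoundedOperators.
Variables (R : realType) (V : normedModType R[i]).

Record bounded_op := BoundedOp {
  bounded_op_fun :> V -> V;
  bounded_op_subproof : bounded_op_fun \in @bounded_linear R V }.

HB.instance Definition _ := [isSub for bounded_op_fun].
HB.instance Definition _ := [Choice of bounded_op by <:].

Lemma bounded_linear_zmod_closed : zmod_closed (@bounded_linear R V).
Proof.
split=> [|S T /asboolP[linS [M SM]] /asboolP[linT [N TN]]]; apply/asboolP; split.
- by move=> a x y; rewrite /GRing.zero/= scaler0 addr0.
- by exists 0 => x; rewrite /GRing.zero/= normr0 mul0r.
- move=> a x y; rewrite (_ : (S - T) _ = S (a *: x + y) - T (a *: x + y))//.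
  by rewrite linS linT opprD addrACA -scalerBr.
- exists (M + N) => x; rewrite (_ : (S - T) x = S x - T x)// mulrDl.
  by rewrite (le_trans (ler_normB _ _))// lerD.
Qed.

HB.instance Definition _ :=
  GRing.isZmodClosed.Build _ (@bounded_linear R V) bounded_linear_zmod_closed.
HB.instance Definition _ := [SubChoice_isSubZmodule of bounded_op by <:].

Lemma bounded_op_linear (T : bounded_op) : linear T.
Proof. by have /asboolP[] := bounded_op_subproof T. Qed.

HB.instance Definition _ (T : bounded_op) :=
  GRing.isLinear.Build R[i] V V *:%R T (@bounded_op_linear T).

Lemma bounded_opP (T : bounded_op) :
  exists M : R[i], forall x, `|T x| <= M * `|x|.
Proof. by have /asboolP[] := bounded_op_subproof T. Qed.

Lemma bounded_op_ext (S T : bounded_op) : S =1 T -> S = T.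
Proof. by move=> ST; apply/val_inj/funext. Qed.

Lemma idfun_bounded_linear : idfun \in @bounded_linear R V.
Proof. by apply/asboolP; split=> //; exists 1 => x; rewrite mul1r. Qed.

Lemma comp_bounded_linear (S T : bounded_op) : S \o T \in @bounded_linear R V.
Proof.
have [[M SM] [N TN]] := (bounded_opP S, bounded_opP T).
apply/asboolP; split=> [a x y|] /=; first by rewrite !linearP.
exists (`|M| * N) => x /=; rewrite (@le_trans _ _ (`|M| * `|T x|))//.
  rewrite -[X in _ <= _ * X]normr_id -normrM ger0_norm//.
  exact: le_trans (SM _).
by rewrite -mulrA ler_wpM2l.
Qed.

Definition bounded_op_one := BoundedOp idfun_bounded_linear.
Definition bounded_op_mul S T := BoundedOp (comp_bounded_linear S T).

Let mulA : associative bounded_op_mul.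
Proof. by move=> S T U; apply: bounded_op_ext. Qed.

Let mul1 : left_id bounded_op_one bounded_op_mul.
Proof. by move=> T; apply: bounded_op_ext. Qed.

Let mulr1 : right_id bounded_op_one bounded_op_mul.
Proof. by move=> T; apply: bounded_op_ext. Qed.

Let mulDl : left_distributive bounded_op_mul +%R.
Proof. by move=> S T U; apply: bounded_op_ext. Qed.

Let mulDr : right_distributive bounded_op_mul +%R.
Proof. by move=> S T U; apply: bounded_op_ext => x; apply: (linearD S). Qed.

(* Possibly zero ring: V may be the zero space. *)
HB.instance Definition _ :=
  GRing.Zmodule_isPzRing.Build bounded_op mulA mul1 mulr1 mulDl mulDr.

End BoundedOperators.

Section GeneralizedDrazin.
Variables (R : realType) (V : normedModType R[i]).
Implicit Types Q S T X : bounded_op V.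

(* Norms of V are elements of R[i] with zero imaginary part, so taking the real
   part makes the operator norm a real number, as powR requires. *)
Definition opnorm T : R :=
  sup [set complex.Re `|T x| | x in [set x : V | `|x| <= 1]].

Definition quasinilpotent Q : Prop :=
  opnorm (Q ^+ n) `^ n%:R^-1 @[n --> \oo] --> (0 : R).

Definition is_gdrazin T X : Prop :=
  [/\ X * T * X = X, T * X = X * T & quasinilpotent (T - T ^+ 2 * X)].

Definition gdrazin_invertible T : Prop := exists X, is_gdrazin T X.

(* The generalized Drazin inverse of T, and 0 if T has none. *)
Definition gdrazin T : bounded_op V := xget 0 [set X | is_gdrazin T X].

Definition inner_inverse T S : Prop := T * S * T = T.

(* The GD1 inverse of T associated with its inner inverse S. *)
Definition gd1 T S : bounded_op V := gdrazin T * T * S.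

End GeneralizedDrazin.

(* Main.v *)
(* Put A = T^2 T^-, X = T^d T T^- and Q = T - T^2 T^d.  From T T^- T^d = T^d one
   gets X A X = X, A X = X A and A - A^2 X = Q (T T^-).  Since (T T^-) Q = Q, the
   n-th power of this residue is Q^n (T T^-), so its norm is at most a constant
   times |Q^n| and it is quasinilpotent.
   If X and Y are generalized Drazin inverses of A, then
   A X (1 - A Y) = X^n (A - A^2 Y)^n for all n > 0.  The n-th root of the norm of
   the right-hand side tends to 0 while the left-hand side is fixed, hence
   A X = A X A Y; symmetrically A Y = A X A Y, so A X = A Y and X = Y. *)

Require Import Defs.
From mathcomp Require Import all_boot all_order all_algebra.
From mathcomp Require Import all_classical all_reals all_analysis.
From mathcomp Require Import complex.
Import GRing.Theory.
Local Open Scope classical_set_scope.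
Local Open Scope ring_scope.
Import Order.TTheory Num.Theory numFieldNormedType.Exports.

Set Implicit Arguments.
Unset Strict Implicit.
Unset Printing Implicit Defensive.

(** * Ring identities for inner and outer inverses *)

Section CornerIdentities.
Variable A : pzRingType.
Implicit Types t s d x : A.

(** Commutation gives [d = t * d * d], so [d] starts with a factor [t], which [t * s] fixes. *)
Lemma mul_inner_inverse_outer t s d :
  t * s * t = t -> d * t * d = d -> t * d = d * t -> t * s * d = d.
Proof. by move=> tst dtd td; rewrite -dtd -td !mulrA tst. Qed.

Lemma gd1_commute t s d :
  t * s * t = t -> d * t * d = d -> t * d = d * t ->
  t ^+ 2 * s * (d * t * s) = d * t * s * (t ^+ 2 * s).
Proof.
move=> tst dtd td.
have -> : t ^+ 2 * s * (d * t * s) = t * (t * s * d) * t * s.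
  by rewrite expr2 !mulrA.
have -> : d * t * s * (t ^+ 2 * s) = d * (t * s * t) * t * s.
  by rewrite expr2 !mulrA.
by rewrite (mul_inner_inverse_outer tst dtd td) tst td.
Qed.

Lemma gd1_outer t s d :
  t * s * t = t -> d * t * d = d -> t * d = d * t ->
  d * t * s * (t ^+ 2 * s) * (d * t * s) = d * t * s.
Proof.
move=> tst dtd td.
have -> : d * t * s * (t ^+ 2 * s) * (d * t * s) =
    d * (t * s * t) * (t * s * d) * t * s by rewrite expr2 !mulrA.
by rewrite (mul_inner_inverse_outer tst dtd td) tst dtd.
Qed.

Lemma gd1_residue t s d :
  t * s * t = t -> d * t * d = d -> t * d = d * t ->
  t ^+ 2 * s - (t ^+ 2 * s) ^+ 2 * (d * t * s) = (t - t ^+ 2 * d) * (t * s).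
Proof.
move=> tst dtd td.
have -> : (t ^+ 2 * s) ^+ 2 * (d * t * s) =
    t * (t * s * t) * (t * s * d) * t * s by rewrite !expr2 !mulrA.
rewrite (mul_inner_inverse_outer tst dtd td) tst.
by rewrite mulrBl expr2 !mulrA.
Qed.

Lemma residue_fixed t s d :
  t * s * t = t -> t * s * (t - t ^+ 2 * d) = t - t ^+ 2 * d.
Proof. by move=> tst; rewrite mulrBr expr2 !mulrA tst. Qed.

(** Every [p] except the last is followed by a [q], which absorbs it. *)
Lemma exprM_fixed_left (q p : A) n :
  p * q = q -> (q * p) ^+ n.+1 = q ^+ n.+1 * p.
Proof.
move=> pq; elim: n => [|n IHn]; first by rewrite !expr1.
by rewrite exprS IHn (exprS q n.+1) -!mulrA (mulrA p) exprS (mulrA p) pq.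
Qed.

Lemma residueE t x : t - t ^+ 2 * x = t * (1 - t * x).
Proof. by rewrite mulrBr mulr1 expr2 mulrA. Qed.

Lemma idem_outer t x : x * t * x = x -> t * x * (t * x) = t * x.
Proof. by move=> xtx; rewrite -mulrA (mulrA x) xtx. Qed.

(** The residue is [t] times the idempotent [1 - t * x], and the two factors commute. *)
Lemma residue_expr t x n : x * t * x = x -> t * x = x * t ->
  (t - t ^+ 2 * x) ^+ n.+1 = t ^+ n.+1 * (1 - t * x).
Proof.
move=> xtx tx; rewrite residueE exprMn_comm; last first.
  by apply: commrB; [exact: commr1 | apply: commrM => //; rewrite /GRing.comm].
congr (_ * _); elim: n => [|n IHn]; first by rewrite expr1.
by rewrite exprS IHn mulrBl mul1r mulrBr mulr1 idem_outer// subrr subr0.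
Qed.

Lemma outer_expr t x n : x * t * x = x -> t * x = x * t ->
  t * x = t ^+ n.+1 * x ^+ n.+1.
Proof.
move=> xtx tx; rewrite -exprMn_comm//.
elim: n => [|n IHn]; first by rewrite expr1.
by rewrite exprS -IHn idem_outer.
Qed.

(** [x] and [y] need not commute: both sides equal [t ^+ n.+1 * x ^+ n.+1 * (1 - t * y)], and only
    [x] is moved past [t]. *)
Lemma mul_residue_expr t x y n :
  x * t * x = x -> t * x = x * t -> y * t * y = y -> t * y = y * t ->
  t * x * (1 - t * y) = x ^+ n.+1 * (t - t ^+ 2 * y) ^+ n.+1.
Proof.
move=> xtx tx yty ty; rewrite residue_expr// mulrA (outer_expr n xtx tx).
by congr (_ * _); apply: commrX; apply/commr_sym/commrX.
Qed.

(** Mirror image of [mul_residue_expr]; here [1 - t * y] is moved past the power of [t]. *)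
Lemma residue_expr_mul t x y n :
  x * t * x = x -> t * x = x * t -> y * t * y = y -> t * y = y * t ->
  (1 - t * y) * (t * x) = (t - t ^+ 2 * y) ^+ n.+1 * x ^+ n.+1.
Proof.
move=> xtx tx yty ty; rewrite residue_expr// (outer_expr n xtx tx) mulrA.
congr (_ * _); apply/commrX/commr_sym/commrB; first exact: commr1.
exact: commrM.
Qed.

End CornerIdentities.

(** * The operator norm as a real number *)

Section OperatorNorm.
Variables (R : realType) (V : normedModType R[i]).
Implicit Types S T : bounded_op V.

Lemma Re_normE (x : V) : `|x| = (complex.Re `|x|)%:C%C.
Proof. by case: `|x| (normr_ge0 x) => a b; rewrite lecE => /andP[/eqP /= ->]. Qed.

Lemma Re_norm_ge0 (x : V) : 0 <= complex.Re `|x|.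
Proof. by move: (normr_ge0 x); rewrite lecE => /andP[]. Qed.

Lemma Re_norm_bounded T :
  exists2 M : R, 0 <= M & forall x, complex.Re `|T x| <= M * complex.Re `|x|.
Proof.
have [M TM] := bounded_opP T.
(* The bound [M] is a complex number, so its modulus serves as the real bound. *)
exists (complex.Re `|M|) => [|x].
  by move: (normr_ge0 M); rewrite lecE => /andP[].
have -> : complex.Re `|M| * complex.Re `|x| = complex.Re (`|M * `|x| |).
  rewrite normrM normr_id (Re_normE x).
  by case: `|M| => a b /=; rewrite mulr0 subr0.
have := TM x; move=> Tx; have := le_trans (normr_ge0 _) Tx => Mx.
by rewrite (ger0_norm Mx); move: Tx; rewrite lecE => /andP[].
Qed.

Lemma opnorm_has_sup T :
  has_sup [set complex.Re `|T x| | x in [set x : V | `|x| <= 1]].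
Proof.
split; first by exists (complex.Re `|T 0|), 0 => //=; rewrite normr0.
have [M M0 TM] := Re_norm_bounded T; exists M => _ [x /= x1 <-].
apply: le_trans (TM x) _; rewrite ler_piMr//.
by move: x1; rewrite lecE => /andP[].
Qed.

Lemma opnorm_ge0 T : 0 <= opnorm T.
Proof.
apply: (le_trans (Re_norm_ge0 (T 0))); apply: ub_le_sup.
  by have [] := opnorm_has_sup T.
by exists 0 => //=; rewrite normr0.
Qed.

Lemma Re_norm_le_opnorm T x : complex.Re `|T x| <= opnorm T * complex.Re `|x|.
Proof.
have [->|x0] := eqVneq x 0; first by rewrite linear0 !normr0 /= mulr0.
set r := complex.Re `|x|; have xr : `|x| = r%:C%C := Re_normE x.
have r0 : 0 < r by rewrite -ltcR -xr normr_gt0.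
rewrite -ler_pdivrMr//; apply: ub_le_sup.
  by have [] := opnorm_has_sup T.
have nr : `|(r^-1)%:C%C : R[i]| = (r^-1)%:C%C.
  by rewrite ger0_norm// lecR invr_ge0 ltW.
(* The supremum is tested on the unit vector in the direction of [x]. *)
exists ((r^-1)%:C%C *: x); rewrite /= ?linearZ normrZ nr.
  by rewrite xr -rmorphM /= mulVf ?gt_eqF.
by rewrite (Re_normE (T x)) -rmorphM /= mulrC.
Qed.

Lemma opnorm_le T M : 0 <= M ->
  (forall x, complex.Re `|T x| <= M * complex.Re `|x|) -> opnorm T <= M.
Proof.
move=> M0 TM; apply: ge_sup; first by have [] := opnorm_has_sup T.
move=> _ [x /= x1 <-]; apply: le_trans (TM x) _; rewrite ler_piMr//.
by move: x1; rewrite lecE => /andP[].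
Qed.

Lemma opnormM S T : opnorm (S * T) <= opnorm S * opnorm T.
Proof.
apply: opnorm_le => [|x]; first by rewrite mulr_ge0 ?opnorm_ge0.
apply: le_trans (Re_norm_le_opnorm S (T x)) _.
by rewrite -mulrA ler_wpM2l ?opnorm_ge0 ?Re_norm_le_opnorm.
Qed.

Lemma opnormXS T n : opnorm (T ^+ n.+1) <= opnorm T ^+ n.+1.
Proof.
elim: n => [|n IHn]; first by rewrite !expr1.
rewrite exprS (exprS (opnorm T)); apply: le_trans (opnormM _ _) _.
by rewrite ler_wpM2l ?opnorm_ge0.
Qed.

Lemma opnorm_eq0 T : opnorm T = 0 -> T = 0.
Proof.
move=> T0; apply: bounded_op_ext => x; apply/eqP; rewrite -normr_eq0 Re_normE.
have := Re_norm_le_opnorm T x; rewrite T0 mul0r => Tx.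
by have /eqP -> : complex.Re `|T x| == 0 by rewrite eq_le Tx Re_norm_ge0.
Qed.

End OperatorNorm.

(** * Limits of n-th roots *)

Section RootTest.
Variable R : realType.
Implicit Types a b : nat -> R.

(** The root equals [c] times a root of [K], and a root of [K] is at most [K] because [1 <= K]. *)
Lemma powR_root_le1M (K c : R) n : 1 <= K -> 0 <= c ->
  (K * c ^+ n.+1) `^ n.+1%:R^-1 <= K * c.
Proof.
move=> K1 c0; have K0 : 0 <= K by rewrite (le_trans _ K1).
rewrite powRM ?exprn_ge0// -powR_mulrn// -powRrM mulfV ?pnatr_eq0// powRr1//.
rewrite ler_wpM2r// -[leRHS]powRr1// ler_powR//.
by rewrite invf_le1 ?ltr0n// ler1n.
Qed.

Lemma root_cvg0_le (K c : R) a b : 1 <= K -> 0 <= c ->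
  (forall n, 0 <= a n) -> (forall n, 0 <= b n) ->
  (forall n, b n.+1 <= K * c ^+ n.+1 * a n.+1) ->
  a n `^ n%:R^-1 @[n --> \oo] --> (0 : R) ->
  b n `^ n%:R^-1 @[n --> \oo] --> (0 : R).
Proof.
move=> K1 c0 a0 b0 ba acv; have K0 : 0 <= K by rewrite (le_trans _ K1).
apply: (@squeeze_cvgr _ _ _ _ (fun=> 0) (fun n => (K * c) * a n `^ n%:R^-1)).
(* The comparison starts at index 1, since [ba] says nothing about index 0. *)
- exists 1%N => // -[|n] //= _; rewrite powR_ge0 /=.
  apply: (@le_trans _ _ ((K * c ^+ n.+1 * a n.+1) `^ n.+1%:R^-1)).
    by apply: ge0_ler_powR; rewrite ?nnegrE ?mulr_ge0 ?exprn_ge0 ?invr_ge0.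
  rewrite powRM ?mulr_ge0 ?exprn_ge0//.
  by rewrite ler_wpM2r ?powR_ge0// powR_root_le1M.
- exact: cvg_cst.
- by rewrite -(mulr0 (K * c)); apply: cvgMl_tmp.
Qed.

Lemma root_cvg0_cst (z : R) : 0 <= z ->
  z `^ n%:R^-1 @[n --> \oo] --> (0 : R) -> z = 0.
Proof.
move=> z0 zcv; apply/eqP; rewrite eq_le z0 andbT leNgt; apply/negP => zp.
(* For [z > 0], every root of index at least 1 is bounded below by [Num.min z 1], hence so is the
   limit. *)
suff : Num.min z 1 <= 0 by rewrite leNgt lt_min zp ltr01.
rewrite -(cvg_lim _ zcv)//; apply: limr_ge; first by apply/cvg_ex; exists 0.
exists 1%N => // -[|n] //= _; have n1 : n.+1%:R^-1 <= 1 :> R.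
  by rewrite invf_le1 ?ltr0n// ler1n.
have [z1|/ltW z1] := leP z 1; first by rewrite ger1_powR ?zp.
by rewrite -[leLHS](powRr0 z) ler_powR ?invr_ge0.
Qed.

End RootTest.

(** * Uniqueness of the generalized Drazin inverse and the GD1 inverse *)

Section GeneralizedDrazinInverse.
Variables (R : realType) (V : normedModType R[i]).
Implicit Types A Q S T X Y Z : bounded_op V.

Lemma quasinilpotent_le Q T (K : R) : 1 <= K -> quasinilpotent Q ->
  (forall n, opnorm (T ^+ n.+1) <= K * opnorm (Q ^+ n.+1)) ->
  quasinilpotent T.
Proof.
move=> K1 Qq QT; apply: (root_cvg0_le (K := K) (c := 1)) Qq => // n; rewrite ?opnorm_ge0//.
by rewrite expr1n mulr1.
Qed.

(** The roots of the constant sequence [opnorm Z] are squeezed to 0, which forces the constant to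
    vanish. *)
Lemma quasinilpotent_le_eq0 Q Z (K c : R) : 1 <= K -> 0 <= c ->
  quasinilpotent Q ->
  (forall n, opnorm Z <= K * c ^+ n.+1 * opnorm (Q ^+ n.+1)) -> Z = 0.
Proof.
move=> K1 c0 Qq QZ; apply/opnorm_eq0/root_cvg0_cst; first exact: opnorm_ge0.
by apply: (root_cvg0_le (K := K) (c := c)) Qq => // n; rewrite opnorm_ge0.
Qed.

(** Uniqueness uses the first product for the pair [X], [Y] and the second for the swapped pair. *)
Lemma gdrazin_proj_mul A X Y : is_gdrazin A X -> is_gdrazin A Y ->
  A * X * (1 - A * Y) = 0 /\ (1 - A * Y) * (A * X) = 0.
Proof.
move=> [xax ax _] [yay ay Yq].
split; apply: (quasinilpotent_le_eq0 (K := 1) (c := opnorm X) _ _ Yq) => [||n].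
- exact: lexx.
- exact: opnorm_ge0.
- rewrite (mul_residue_expr n xax ax yay ay) mul1r.
  apply: le_trans (opnormM _ _) _.
  by apply: ler_wpM2r; [exact: opnorm_ge0 | exact: opnormXS].
- exact: lexx.
- exact: opnorm_ge0.
- rewrite (residue_expr_mul n xax ax yay ay) mul1r [leRHS]mulrC.
  apply: le_trans (opnormM _ _) _.
  by apply: ler_wpM2l; [exact: opnorm_ge0 | exact: opnormXS].
Qed.

Lemma is_gdrazin_unique A X Y : is_gdrazin A X -> is_gdrazin A Y -> X = Y.
Proof.
move=> AX AY.
have [/eqP + _] := gdrazin_proj_mul AX AY.
rewrite mulrBr mulr1 subr_eq0 => /eqP XXY.
have [_ /eqP +] := gdrazin_proj_mul AY AX.
rewrite mulrBl mul1r subr_eq0 => /eqP YXY.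
have AXY : A * X = A * Y by rewrite XXY -YXY.
have [[xax ax _] [yay ay _]] := (AX, AY).
(* [X = X A X = X A Y = A X Y = A Y Y = Y A Y = Y]. *)
by rewrite -xax -mulrA AXY mulrA -ax AXY ay.
Qed.

(** [gdrazin] selects some witness by choice; uniqueness identifies it with [X]. *)
Lemma gdrazinE A X : is_gdrazin A X -> gdrazin A = X.
Proof. by move=> AX; apply: is_gdrazin_unique (AX); apply: xgetI AX. Qed.

Lemma gdrazinP A : gdrazin_invertible A -> is_gdrazin A (gdrazin A).
Proof. by move=> [X AX]; apply: xgetI AX. Qed.

Lemma is_gdrazin_gd1 T S : gdrazin_invertible T -> inner_inverse T S ->
  is_gdrazin (T ^+ 2 * S) (gd1 T S).
Proof.
move=> /gdrazinP[dtd td Tq] tst; rewrite /gd1; split.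
- exact: gd1_outer.
- exact: gd1_commute.
- rewrite (gd1_residue tst dtd td).
  (* [opnorm (T * S)] bounds the factor left over in each power; the maximum with 1 ensures
     [1 <= K]. *)
  apply: (quasinilpotent_le (K := Num.max 1 (opnorm (T * S))) _ Tq) => [|n].
    by rewrite le_max lexx.
  rewrite (exprM_fixed_left _ (residue_fixed _ tst)).
  apply: le_trans (opnormM _ _) _; rewrite mulrC.
  by rewrite ler_wpM2r ?opnorm_ge0// le_max lexx orbT.
Qed.

End GeneralizedDrazinInverse.

Theorem theorem8 (R : realType) (H : hilbertType R) (T Tm : bounded_op H)
    (T_gdrazin : gdrazin_invertible T) (T_closed_range : closed (range T))
    (Tm_inner : inner_inverse T Tm) :
  gdrazin_invertible (T ^+ 2 * Tm) /\ gdrazin (T ^+ 2 * Tm) = gd1 T Tm.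
Proof.
have G := is_gdrazin_gd1 T_gdrazin Tm_inner.
by split; [exists (gd1 T Tm) | exact: gdrazinE].
Qed.
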